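(* Let $p\ge3$ and $\lambda=\lambda_p=2\cos(\pi/p)$. Suppose $\mathcal A$ is a hyperbolic equivalence class of $\lambda$-BQFs with associated ISP $P_{\mathcal A}$, and let $W$ be a product of conjugacy class generators representing the corresponding primitive hyperbolic conjugacy class (the class of elements $M$ with $Q_M\in\mathcal A$). The following are equivalent: (a) $P_{\mathcal A}$ has Hecke-symmetry, i.e. $P_{\mathcal A}'=P_{\mathcal A}$; (b) $\mathcal M_{\mathcal A}^{\top}=\mathcal M_{\mathcal A}$; (c) $W^{\top}\sim W$ (conjugate in $G_p$); (d) $W^{\top}$ is a cyclic permutation of $W$, where for $W=V_{j_1}\cdots V_{j_n}$ one has $W^{\top}=V_{p-j_n}\cdots V_{p-j_1}$.
   Context: Let $S=\begin{pmatrix}1&\lambda\\0&1\end{pmatrix}$, $T=\begin{pmatrix}0&-1\\1&0\end{pmatrix}$, $U=ST$, $G_p=\langle S,T\rangle/\{\pm I\}$ acting by Möbius transformations; elements represented by matrices of positive trace; hyperbolic: $|\mathrm{tr}|>2$; primitive: not a $k$-th power, $k\ge2$. Conjugacy class generators: $V_j=U^{j-1}S$, $1\le j\le p-1$; every non-elliptic element is conjugate to a product of $V_j$'s unique up to cyclic permutation. A hyperbolic number is a fixed point of a hyperbolic element; its Hecke-conjugate $\alpha'$ is the other fixed point; $R'=\{x':x\in R\}$. A $\lambda$-BQF is $Ax^2+Bxy+Cy^2$ with coefficients in $\mathbb Z[\lambda]$, with $G_p$-action $(Q\circ M)(x,y)=Q(ax+by,cx+dy)$ and induced equivalence. For primitive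 hyperbolic $M=\begin{pmatrix}a&b\\c&d\end{pmatrix}$ of positive trace, $Q_M=[c,d-a,-b]$; for hyperbolic $\alpha$, $M_\alpha$ is the primitive hyperbolic element with attracting fixed point $\alpha$ and $Q_\alpha=Q_{M_\alpha}$. $\alpha$ is simple if $\alpha'<0<\alpha$. For a class $\mathcal A$: $\mathcal Z_{\mathcal A}=\{\alpha\text{ simple}:Q_\alpha\in\mathcal A\}$; the ISP (irreducible system of poles of rational period functions on $G_p$) is $P_{\mathcal A}=\mathcal Z_{\mathcal A}\cup T\mathcal Z_{\mathcal A}$; $\mathcal M_{\mathcal A}=\{M_\alpha:\alpha\in\mathcal Z_{\mathcal A}\}$ and $\mathcal M_{\mathcal A}^{\top}=\{M^{\top}:M\in\mathcal M_{\mathcal A}\}$. *)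

(* Defs.v *)
From mathcomp Require Import all_boot all_order all_algebra.
From mathcomp Require Import ring.
From mathcomp Require Import all_classical all_reals all_analysis.

Set Implicit Arguments.
Unset Strict Implicit.
Unset Printing Implicit Defensive.

Import Order.TTheory GRing.Theory Num.Theory.
Import numFieldNormedType.Exports.

Local Open Scope classical_set_scope.
Local Open Scope ring_scope.

Definition mx2 (R : realType) (a b c d : R) : 'M[R]_2 :=
  \matrix_(i < 2, j < 2)
    (if i == 0 then (if j == 0 then a else b) else (if j == 0 then c else d)).

Definition lambda (R : realType) (p : nat) : R := 2 * cos (pi / p%:R).

Definition heckeS (R : realType) (p : nat) : 'M[R]_2 := mx2 1 (lambda R p) 0 1.
Definition heckeT (R : realType) : 'M[R]_2 := mx2 0 (-1) 1 0.
Definition heckeU (R : realType) (p : nat) : 'M[R]_2 := heckeS R p *m heckeT R.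

(* The matrix group <S, T>.  The Hecke group G_p is its quotient by {I, -I}:
   elements of G_p are given by matrices of <S, T>, compared with [projeq]. *)
Inductive heckeG (R : realType) (p : nat) : 'M[R]_2 -> Prop :=
  | heckeG_S : heckeG p (heckeS R p)
  | heckeG_T : heckeG p (heckeT R)
  | heckeG_1 : heckeG p 1%:M
  | heckeG_M M N : heckeG p M -> heckeG p N -> heckeG p (M *m N)
  | heckeG_V M : heckeG p M -> heckeG p (invmx M).

Definition projeq (R : realType) (M N : 'M[R]_2) : Prop := M = N \/ M = - N.

Definition hecke_conjugate (R : realType) (p : nat) (M N : 'M[R]_2) : Prop :=
  exists2 g, heckeG p g & projeq N (invmx g *m M *m g).

Definition hyperbolic (R : realType) (M : 'M[R]_2) : Prop := 2 < `|\tr M|.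

Definition primitive (R : realType) (p : nat) (M : 'M[R]_2) : Prop :=
  ~ exists N k, [/\ heckeG p N, (2 <= k)%N & projeq M (N ^+ k)].

(* The representatives of positive trace of the primitive hyperbolic elements of
   G_p; each such element has exactly one. *)
Definition prim_hyp (R : realType) (p : nat) : set 'M[R]_2 :=
  [set M | [/\ heckeG p M, 0 < \tr M, hyperbolic M & primitive p M]].

Definition mobius (R : realType) (M : 'M[R]_2) (x : R) : R :=
  (M 0 0 * x + M 0 1) / (M 1 0 * x + M 1 1).

(* A zero denominator means that [x] is sent to infinity. *)
Definition fixed_point (R : realType) (M : 'M[R]_2) (x : R) : Prop :=
  M 1 0 * x + M 1 1 != 0 /\ mobius M x = x.

Definition attracting (R : realType) (M : 'M[R]_2) (x : R) : Prop :=
  fixed_point M x /\ `|derive1 (mobius M) x| < 1.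

(* [hconj p x y]: [x] is a hyperbolic number and [y] is its Hecke-conjugate. *)
Definition hconj (R : realType) (p : nat) (x y : R) : Prop :=
  exists M, [/\ heckeG p M, hyperbolic M, fixed_point M x, fixed_point M y
              & y <> x].

Definition hconj_set (R : realType) (p : nat) (X : set R) : set R :=
  [set y | exists2 x, X x & hconj p x y].

Definition simple (R : realType) (p : nat) (x : R) : Prop :=
  exists2 y, hconj p x y & y < 0 < x.

(* [BQF A B C] is the form A x^2 + B x y + C y^2. *)
Record bqf (R : realType) := BQF { bqfA : R; bqfB : R; bqfC : R }.

Definition bqf_eval (R : realType) (Q : bqf R) (x y : R) : R :=
  bqfA Q * x ^+ 2 + bqfB Q * x * y + bqfC Q * y ^+ 2.

Definition Zlambda (R : realType) (p : nat) : set R :=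
  [set x | exists q : {poly int}, x = (map_poly intr q).[lambda R p]].

Definition lambda_bqf (R : realType) (p : nat) (Q : bqf R) : Prop :=
  [/\ Zlambda p (bqfA Q), Zlambda p (bqfB Q) & Zlambda p (bqfC Q)].

Definition bqf_act (R : realType) (Q : bqf R) (M : 'M[R]_2) : bqf R :=
  let: BQF A B C := Q in
  let a := M 0 0 in let b := M 0 1 in let c := M 1 0 in let d := M 1 1 in
  BQF (A * a ^+ 2 + B * a * c + C * c ^+ 2)
      (2 * A * a * b + B * (a * d + b * c) + 2 * C * c * d)
      (A * b ^+ 2 + B * b * d + C * d ^+ 2).

Lemma bqf_actE (R : realType) (Q : bqf R) (M : 'M[R]_2) (x y : R) :
  bqf_eval (bqf_act Q M) x y
  = bqf_eval Q (M 0 0 * x + M 0 1 * y) (M 1 0 * x + M 1 1 * y).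
Proof. by case: Q => A B C; rewrite /bqf_eval /=; ring. Qed.

Definition bqf_equiv (R : realType) (p : nat) (Q Q' : bqf R) : Prop :=
  exists2 M, heckeG p M & Q' = bqf_act Q M.

Definition bqf_class (R : realType) (p : nat) (A : set (bqf R)) : Prop :=
  exists2 Q, lambda_bqf p Q & A = [set Q' | lambda_bqf p Q' /\ bqf_equiv p Q Q'].

Definition bqf_of_mx (R : realType) (M : 'M[R]_2) : bqf R :=
  BQF (M 1 0) (M 1 1 - M 0 0) (- M 0 1).

Definition hyperbolic_bqf (R : realType) (p : nat) (Q : bqf R) : Prop :=
  exists2 M, prim_hyp p M & Q = bqf_of_mx M.

Definition hyperbolic_class (R : realType) (p : nat) (A : set (bqf R)) : Prop :=
  bqf_class p A /\ A `<=` hyperbolic_bqf p.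

(* [Malpha p x M]: [M] is M_x, the primitive hyperbolic element with attracting
   fixed point [x]. *)
Definition Malpha (R : realType) (p : nat) (x : R) (M : 'M[R]_2) : Prop :=
  prim_hyp p M /\ attracting M x.

(* [Qalpha p x Q]: [Q] is the form Q_x. *)
Definition Qalpha (R : realType) (p : nat) (x : R) (Q : bqf R) : Prop :=
  exists2 M, Malpha p x M & Q = bqf_of_mx M.

Definition Zset (R : realType) (p : nat) (A : set (bqf R)) : set R :=
  [set x | simple p x /\ exists2 Q, Qalpha p x Q & A Q].

Definition ISP (R : realType) (p : nat) (A : set (bqf R)) : set R :=
  Zset p A `|` mobius (heckeT R) @` Zset p A.

Definition Mset (R : realType) (p : nat) (A : set (bqf R)) : set 'M[R]_2 :=
  [set M | exists2 x, Zset p A x & Malpha p x M].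

(* The elements M of G_p, given by either representative, with Q_M in A. *)
Definition conj_class_of (R : realType) (p : nat) (A : set (bqf R)) :
    set 'M[R]_2 :=
  [set N | exists M, [/\ projeq N M, prim_hyp p M & A (bqf_of_mx M)]].

Definition Vgen (R : realType) (p j : nat) : 'M[R]_2 :=
  heckeU R p ^+ j.-1 *m heckeS R p.

(* A word [:: j_1; ...; j_n] in the conjugacy class generators and its value
   V_{j_1} ... V_{j_n}. *)
Definition Vword (p : nat) (js : seq nat) : Prop :=
  {in js, forall j, (1 <= j <= p - 1)%N}.

Definition Vprod (R : realType) (p : nat) (js : seq nat) : 'M[R]_2 :=
  \prod_(j <- js) Vgen R p j.

Definition tr_word (p : nat) (js : seq nat) : seq nat :=
  [seq (p - j)%N | j <- rev js].

Definition cyclic_perm (s t : seq nat) : Prop := exists k, s = rot k t.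

(* Main.v *)
(** With s_j = sin (j pi / p) / sin (pi / p), the generator V_j is the matrix
    [[s_j, s_(j+1)], [s_(j-1), s_j]]: it is entrywise at least the identity, and
    its transpose is V_(p-j).  The V_j generate a free monoid, and every element
    of the Hecke group is, up to sign, T^a w T^b with w a word in the V_j.
    Hence the group is discrete, so that hyperbolic elements with a common fixed
    point commute; its elements with positive entries are words; and two words
    are conjugate only if they are cyclic permutations of each other, which
    settles the last two conditions.

    A primitive hyperbolic element with attracting fixed point x > 0 and
    repelling fixed point y < 0 has positive entries, so it is a word.  Commuting
    words are powers of a common one, so this element is determined by x.
    Transposition replaces (x, y) by (- 1 / y, - 1 / x), which are the images of
    y and x under T; therefore both the Hecke-symmetry of the poles and the
    symmetry of the set of matrices say that the positive matrices of the
    conjugacy class are stable under transposition. *)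

Require Import Defs.
From mathcomp Require Import all_boot all_order all_algebra.
From mathcomp Require Import ring lra zify.
From mathcomp Require Import all_classical all_reals all_analysis.

Set Implicit Arguments.
Unset Strict Implicit.
Unset Printing Implicit Defensive.

Import Order.TTheory GRing.Theory Num.Theory.
Import numFieldNormedType.Exports.

Local Open Scope classical_set_scope.
Local Open Scope ring_scope.

(** * Two-by-two matrices entrywise, and equality up to sign *)

Section Matrices.
Variable R : realType.
Implicit Types M N : 'M[R]_2.

Lemma mx2_eq M N : M 0 0 = N 0 0 -> M 0 1 = N 0 1 -> M 1 0 = N 1 0 ->
  M 1 1 = N 1 1 -> M = N.
Proof.
have ord2 (k : 'I_2) : k = 0 \/ k = 1.
  by case: k => [[|[|//]] kP]; [left|right]; exact/val_inj.
by move=> h00 h01 h10 h11; apply/matrixP => i j;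
   case: (ord2 i) => ->; case: (ord2 j) => ->.
Qed.

Lemma mul2E M N i j : (M * N) i j = M i 0 * N 0 j + M i 1 * N 1 j.
Proof.
rewrite mxE !big_ord_recl big_ord0 addr0.
by congr (M i _ * N _ j + M i _ * N _ j); exact/val_inj.
Qed.

Lemma det2E M : \det M = M 0 0 * M 1 1 - M 0 1 * M 1 0.
Proof.
rewrite (expand_det_row _ 0) !big_ord_recl big_ord0 addr0 /cofactor !det_mx11.
rewrite !mxE /= expr0 expr1 mulN1r mul1r mulrN.
by congr (_ * M _ _ - M _ _ * M _ _); exact/val_inj.
Qed.

Lemma tr2E M : \tr M = M 0 0 + M 1 1.
Proof.
rewrite /mxtrace !big_ord_recl big_ord0 addr0.
by congr (_ + M _ _); exact/val_inj.
Qed.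

Lemma mx2E (a b c d : R) :
  ((mx2 a b c d 0 0 = a) * (mx2 a b c d 0 1 = b) *
   (mx2 a b c d 1 0 = c) * (mx2 a b c d 1 1 = d))%type.
Proof. by rewrite !mxE. Qed.

Lemma one2E : (((1 : 'M[R]_2) 0 0 = 1) * ((1 : 'M[R]_2) 0 1 = 0) *
   ((1 : 'M[R]_2) 1 0 = 0) * ((1 : 'M[R]_2) 1 1 = 1))%type.
Proof. by rewrite !mxE. Qed.

Lemma opp2E M i j : (- M) i j = - M i j.
Proof. by rewrite mxE. Qed.

Lemma det1_unit M : \det M = 1 -> M \is a GRing.unit.
Proof. by move=> M1; rewrite unitmxE M1 unitr1. Qed.

Lemma inv2E M : \det M = 1 -> M^-1 = mx2 (M 1 1) (- M 0 1) (- M 1 0) (M 0 0).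
Proof.
move=> M1; apply: (mulrI (det1_unit M1)); rewrite divrr ?det1_unit //.
by move: M1; rewrite det2E => M1;
   apply: mx2_eq; rewrite mul2E !mx2E one2E; lra.
Qed.

Lemma projeq_refl M : projeq M M. Proof. by left. Qed.

Lemma projeqN M : projeq (- M) M. Proof. by right. Qed.

Lemma projeq_trans M N K : projeq M N -> projeq N K -> projeq M K.
Proof.
by case=> -> [] ->; rewrite ?opprK; [left|right|right|left].
Qed.

Lemma projeqM M M' N N' : projeq M N -> projeq M' N' ->
  projeq (M * M') (N * N').
Proof.
by case=> -> [] ->; rewrite ?mulrN ?mulNr ?opprK; [left|right|right|left].
Qed.

Lemma projeq_trmx M N : projeq M N -> projeq M^T N^T.
Proof. by case=> ->; [left|right; rewrite raddfN]. Qed.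

Lemma projeq_tr_eq M N : 0 < \tr M -> 0 < \tr N -> projeq M N -> M = N.
Proof. by move=> M0 N0 [//|MN]; move: M0; rewrite MN raddfN oppr_gt0 (lt_gtF N0). Qed.

Lemma trmxMr M N : (M * N)^T = N^T * M^T. Proof. exact: trmx_mul. Qed.

Lemma trmxVr M : (M^-1)^T = (M^T)^-1. Proof. exact: trmx_inv. Qed.

Lemma trmxXr M k : (M ^+ k)^T = M^T ^+ k.
Proof.
elim: k => [|k ih]; first by rewrite !expr0 trmx1.
by rewrite exprS exprSr trmxMr ih.
Qed.

Lemma trmx2E M : ((M^T 0 0 = M 0 0) * (M^T 0 1 = M 1 0) *
   (M^T 1 0 = M 0 1) * (M^T 1 1 = M 1 1))%type.
Proof. by rewrite !mxE. Qed.

End Matrices.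

(** * Sine quotients at multiples of [pi / p] *)

Section Chebyshev.
Variables (R : realType) (p : nat).
Hypothesis p_ge3 : (3 <= p)%N.

Let theta : R := pi / p%:R.

(** This is the Chebyshev polynomial of the second kind of index [j - 1] at [cos theta]; since
    [lambda] is [2 * cos theta], it obeys the recurrence [chebSS]. *)
Definition cheb (j : nat) : R := sin (j%:R * theta) / sin theta.

Let p_gt0 : 0 < p%:R :> R. Proof. by rewrite ltr0n; lia. Qed.

Let ptheta : p%:R * theta = pi.
Proof. by rewrite /theta mulrC divfK // lt0r_neq0. Qed.

Let theta_gt0 : 0 < theta. Proof. by rewrite divr_gt0 // pi_gt0. Qed.

Let mtheta m n : (m <= n)%N -> m%:R * theta <= n%:R * theta.
Proof. by move=> mn; rewrite ler_pM2r // ler_nat. Qed.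

Let sin_theta : 0 < sin theta.
Proof.
apply: sin_gt0_pi; rewrite theta_gt0 -ptheta -[ltLHS]mul1r ltr_pM2r //.
by rewrite ltr1n; lia.
Qed.

Lemma cheb0 : cheb 0 = 0. Proof. by rewrite /cheb mul0r sin0 mul0r. Qed.

Lemma cheb1 : cheb 1 = 1.
Proof. by rewrite /cheb mul1r divff // lt0r_neq0. Qed.

Lemma chebSS j : cheb j.+2 = lambda R p * cheb j.+1 - cheb j.
Proof.
have -> : cheb j = sin (j.+1%:R * theta - theta) / sin theta.
  by rewrite /cheb; congr (sin _ / _); rewrite -natr1; ring.
have -> : cheb j.+2 = sin (j.+1%:R * theta + theta) / sin theta.
  by rewrite /cheb; congr (sin _ / _); rewrite -(natr1 j.+1); ring.
by rewrite /cheb /lambda -/theta sinB sinD; ring.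
Qed.

Lemma cheb_sub j : (j <= p)%N -> cheb (p - j) = cheb j.
Proof.
move=> jp; rewrite /cheb natrB // mulrBl ptheta.
by rewrite sinB sinpi cospi; congr (_ / _); ring.
Qed.

Lemma cheb_p : cheb p = 0. Proof. by rewrite -[p]subn0 cheb_sub ?cheb0. Qed.

Lemma cheb_ge1 j : (1 <= j <= p - 1)%N -> 1 <= cheb j.
Proof.
move=> /andP[j1 jp]; rewrite /cheb ler_pdivlMr // mul1r -subr_ge0.
(* By sum to product, [sin (a + b) - sin (a - b)] is [2 * cos a * sin b], and both [a] and [b] lie
   in [[0, pi / 2]]. *)
pose a := (j.+1%:R * theta) / 2; pose b := (j.-1%:R * theta) / 2.
have jE : (j.-1)%:R = j%:R - 1 :> R by rewrite -subn1 natrB.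
have -> : j%:R * theta = a + b by rewrite /a /b jE -natr1; lra.
have -> : theta = a - b by rewrite /a /b jE -natr1; lra.
have a0 : 0 <= a by rewrite /a divr_ge0 // mulr_ge0 // ltW.
have b0 : 0 <= b by rewrite /b divr_ge0 // mulr_ge0 // ltW.
have ap : a <= pi / 2.
  by rewrite /a ler_pM2r ?invr_gt0 // -ptheta mtheta //; lia.
have bp : b <= pi / 2.
  by rewrite /b ler_pM2r ?invr_gt0 // -ptheta mtheta //; lia.
have pi0 := pi_gt0 R.
have ca : 0 <= cos a by apply: cos_ge0_pihalf; apply/andP; split; lra.
have sb : 0 <= sin b by apply: sin_ge0_pi; apply/andP; split; lra.
by rewrite sinD sinB; have := mulr_ge0 ca sb; lra.
Qed.

Lemma cheb_ge0 j : (j <= p)%N -> 0 <= cheb j.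
Proof.
move=> jp; have [->|j0] := eqVneq j 0%N; first by rewrite cheb0.
have [->|j1] := eqVneq j p; first by rewrite cheb_p.
by apply: le_trans (@cheb_ge1 j _) => //; lia.
Qed.

End Chebyshev.

(** * The generators V_j: freeness of their monoid and normal forms in the group *)

Section Words.
Variables (R : realType) (p : nat).
Hypothesis p_ge3 : (3 <= p)%N.
Implicit Types (M N : 'M[R]_2) (u v w : seq nat).

Local Notation s := (cheb R p).
Local Notation S := (heckeS R p).
Local Notation T := (heckeT R).
Local Notation U := (heckeU R p).
Local Notation V := (Vgen R p).
Local Notation Vprod := (Vprod R p).

Lemma heckeT_sq : T * T = -1.
Proof. by apply: mx2_eq; rewrite mul2E opp2E !mx2E one2E; ring. Qed.

Lemma heckeSE : S = - (U * T).
Proof.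
by rewrite /heckeU mulmxE -mulrA heckeT_sq mulrN mulr1 opprK.
Qed.

Lemma cheb2 : s 2 = lambda R p.
Proof. by rewrite chebSS cheb1 // cheb0 mulr1 subr0. Qed.

Lemma heckeUE : U = mx2 (lambda R p) (-1) 1 0.
Proof.
by apply: mx2_eq; rewrite /heckeU mulmxE mul2E !mx2E; ring.
Qed.

(** [U] has trace [lambda] and determinant 1, so by Cayley-Hamilton its powers obey [chebSS].
    Starting at exponent 1 avoids an index [- 1] in the last entry. *)
Lemma heckeU_X j : U ^+ j.+1 = mx2 (s j.+2) (- s j.+1) (s j.+1) (- s j).
Proof.
elim: j => [|j ih]; first by rewrite expr1 heckeUE cheb2 cheb1 // cheb0 oppr0.
rewrite exprS ih heckeUE.
by apply: mx2_eq; rewrite mul2E !mx2E 1?(chebSS _ _ j.+1) ?(chebSS _ _ j); ring.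
Qed.

Lemma heckeU_p : U ^+ p = -1.
Proof.
have pE : p.-1.+1 = p by lia.
have s1 : s p.-1 = 1 by rewrite -subn1 cheb_sub ?cheb1 //; lia.
have sS : s p.+1 = -1 by have := chebSS R p p.-1; rewrite pE cheb_p // s1; lra.
have := heckeU_X p.-1; rewrite pE sS s1 cheb_p // => ->.
by apply: mx2_eq; rewrite opp2E mx2E one2E; ring.
Qed.

(** In this form, left multiplication by a power of [U] only shifts the index. The condition [0 < j]
    matters: by truncation [V 0] equals [V 1]. *)
Lemma Vgen_heckeU j : (0 < j)%N -> V j = - (U ^+ j * T).
Proof.
by case: j => // j _; rewrite /Vgen mulmxE heckeSE mulrN mulrA -exprSr.
Qed.

Lemma Vgen_mx2 j : (0 < j)%N -> V j = mx2 (s j) (s j.+1) (s j.-1) (s j).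
Proof.
case: j => // j _; rewrite Vgen_heckeU // heckeU_X.
by apply: mx2_eq; rewrite opp2E mul2E !mx2E; ring.
Qed.

Lemma Vgen_trmx j : (1 <= j <= p - 1)%N -> (V j)^T = V (p - j).
Proof.
move=> jp; rewrite !Vgen_mx2; try lia.
have e1 : (p - j).+1 = (p - j.-1)%N by lia.
have e2 : (p - j).-1 = (p - j.+1)%N by lia.
rewrite e1 e2 !cheb_sub; try lia.
by apply: mx2_eq; rewrite trmx2E !mx2E.
Qed.

Lemma Vword_cons j w :
  Vword p (j :: w) <-> (1 <= j <= p - 1)%N /\ Vword p w.
Proof.
split=> [jw|[jp wp] i]; last by rewrite inE => /predU1P[->|/wp].
by split=> [|i iw]; apply: jw; rewrite inE ?eqxx ?iw ?orbT.
Qed.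

Lemma Vword_cat u v : Vword p (u ++ v) <-> Vword p u /\ Vword p v.
Proof.
split=> [uv|[up vp] i]; last by rewrite mem_cat => /orP[/up|/vp].
by split=> i iw; apply: uv; rewrite mem_cat iw ?orbT.
Qed.

Lemma Vword_tr_word w : Vword p w -> Vword p (tr_word p w).
Proof.
move=> wp i /mapP[j]; rewrite mem_rev => /wp jp ->; lia.
Qed.

Lemma tr_wordK w : Vword p w -> tr_word p (tr_word p w) = w.
Proof.
move=> wp; rewrite /tr_word -map_rev revK -map_comp -[RHS]map_id.
by apply/eq_in_map => j /wp jp /=; lia.
Qed.

Lemma Vprod_nil : Vprod [::] = 1. Proof. exact: big_nil. Qed.

Lemma Vprod_cons j w : Vprod (j :: w) = V j * Vprod w.
Proof. exact: big_cons. Qed.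

Lemma Vprod_cat u v : Vprod (u ++ v) = Vprod u * Vprod v.
Proof. exact: big_cat. Qed.

Lemma Vprod_trmx w : Vword p w -> (Vprod w)^T = Vprod (tr_word p w).
Proof.
elim: w => [|j w ih]; first by rewrite Vprod_nil trmx1.
move=> /Vword_cons[jp wp]; rewrite Vprod_cons trmxMr ih // Vgen_trmx //.
by rewrite /tr_word rev_cons map_rcons -cats1 Vprod_cat Vprod_cons Vprod_nil mulr1.
Qed.

Definition ge1mx M : bool := [&& 1 <= M 0 0, 0 <= M 0 1, 0 <= M 1 0 & 1 <= M 1 1].

Lemma ge1mxM M N : ge1mx M -> ge1mx N -> ge1mx (M * N).
Proof.
move=> /and4P[a b c d] /and4P[a' b' c' d']; rewrite /ge1mx !mul2E.
by apply/and4P; split; nra.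
Qed.

Lemma ge1mx_Vgen j : (1 <= j <= p - 1)%N -> ge1mx (V j).
Proof.
move=> jp; rewrite Vgen_mx2; last lia.
by rewrite /ge1mx !mx2E !cheb_ge1 // !cheb_ge0 //; lia.
Qed.

Lemma ge1mx_Vprod w : Vword p w -> ge1mx (Vprod w).
Proof.
elim: w => [|j w ih]; first by rewrite Vprod_nil /ge1mx !one2E !lexx.
move=> /Vword_cons[jp wp]; rewrite Vprod_cons.
by apply: ge1mxM; [exact: ge1mx_Vgen|exact: ih].
Qed.

(** The upper entry [s (j + 1)] vanishes only for [j = p - 1], and there the lower entry is
    [s (p - 2)], at least 1 because [p >= 3]. *)
Lemma Vgen_offdiag j : (1 <= j <= p - 1)%N -> 1 <= V j 0 1 \/ 1 <= V j 1 0.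
Proof.
move=> jp; rewrite Vgen_mx2 ?mx2E; last lia.
by have [->|jp1] := eqVneq j (p - 1)%N; [right|left]; apply: cheb_ge1 => //; lia.
Qed.

(** A uniform gap between nonempty words and the identity; it serves both freeness and
    discreteness. *)
Lemma Vprod_cons_offdiag j w : Vword p (j :: w) ->
  1 <= Vprod (j :: w) 0 1 + Vprod (j :: w) 1 0.
Proof.
move=> /Vword_cons[jp wp]; rewrite Vprod_cons !(mul2E (V j)).
have /and4P[a b c d] := ge1mx_Vprod wp.
have /and4P[a' b' c' d'] := ge1mx_Vgen jp.
have ge0 (x : R) : 1 <= x -> 0 <= x by exact: le_trans.
have h1 := mulr_ge0 (ge0 _ a') b; have h2 := mulr_ge0 b' (ge0 _ d).
have h3 := mulr_ge0 c' (ge0 _ a); have h4 := mulr_ge0 (ge0 _ d') c.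
suff : 1 <= V j 0 1 \/ 1 <= V j 1 0.
  by case=> h; [have := mulr_ege1 h d|have := mulr_ege1 h a]; lra.
exact: Vgen_offdiag.
Qed.

Lemma Vprod_eq1 w : Vword p w -> Vprod w = 1 -> w = [::].
Proof.
case: w => // j w /Vprod_cons_offdiag + w1.
by rewrite w1 !one2E addr0 ler10.
Qed.

Lemma heckeT_unit : T \is a GRing.unit.
Proof. by apply: det1_unit; rewrite det2E !mx2E; ring. Qed.

Lemma heckeU_unit : U \is a GRing.unit.
Proof. by apply: det1_unit; rewrite heckeUE det2E !mx2E; ring. Qed.

(* Cancelling [U ^+ i] would exhibit the nonnegative matrix
   [V (j - i) * N] as [- (T * M)], whose bottom row is [- M 0 _]. *)
Lemma Vgen_mul_neq i j M N : (0 < i < j)%N -> (j <= p - 1)%N ->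
  ge1mx M -> ge1mx N -> V i * M <> V j * N.
Proof.
move=> /andP[i0 ij] jp M1 N1; rewrite !Vgen_heckeU; try lia.
have -> : j = (i + (j - i))%N by lia.
rewrite exprD !mulNr -!mulrA => /oppr_inj.
move=> /(mulrI (unitrX i heckeU_unit)) TMN.
have VN : V (j - i) * N = - (T * M).
  by rewrite TMN Vgen_heckeU ?subn_gt0 // mulNr mulrA.
have jip : (1 <= j - i <= p - 1)%N by lia.
have /and4P[_ _ c _] := ge1mxM (ge1mx_Vgen jip) N1.
have /and4P[a _ _ _] := M1.
move: c; rewrite VN opp2E mul2E !mx2E {VN TMN}; lra.
Qed.

Lemma Vgen_unit j : (0 < j)%N -> V j \is a GRing.unit.
Proof.
move=> j0; rewrite Vgen_heckeU // unitrN unitrMl ?heckeT_unit //.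
exact/unitrX/heckeU_unit.
Qed.

(** Distinct first letters are excluded by [Vgen_mul_neq], and equal ones are cancelled. *)
Lemma Vprod_inj u v : Vword p u -> Vword p v -> Vprod u = Vprod v -> u = v.
Proof.
elim: u v => [|i u ih] [|j v] //.
- by rewrite Vprod_nil => _ vp /esym/(Vprod_eq1 vp).
- by rewrite Vprod_nil => up _ /(Vprod_eq1 up).
move=> /Vword_cons[ip up] /Vword_cons[jp vp]; rewrite !Vprod_cons => uv.
have [ij|ji|ij] := ltngtP i j.
- by exfalso; move: uv; apply: Vgen_mul_neq; rewrite ?ge1mx_Vprod //; lia.
- by exfalso; move/esym: uv; apply: Vgen_mul_neq; rewrite ?ge1mx_Vprod //; lia.
rewrite ij in uv *; congr cons; apply: ih => //.
by apply: mulrI uv; apply: Vgen_unit; lia.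
Qed.

Lemma heckeG_det M : heckeG p M -> \det M = 1.
Proof.
elim=> {M} [|||M N _ M1 _ N1|M _ M1].
- by rewrite det2E !mx2E; ring.
- by rewrite det2E !mx2E; ring.
- exact: det1.
- by rewrite det_mulmx M1 N1 mulr1.
- by rewrite det_inv M1 invr1.
Qed.

Definition normal_form M := exists (a b : bool) w,
  Vword p w /\ projeq M (T ^+ a * Vprod w * T ^+ b).

Lemma normal_form_projeq M N : projeq M N -> normal_form N -> normal_form M.
Proof.
by move=> MN [a [b [w [wp Nw]]]]; exists a, b, w; split=> //; apply: projeq_trans Nw.
Qed.

Lemma normal_form_T M : normal_form M -> normal_form (T * M).
Proof.
move=> [a [b [w [wp Mw]]]]; exists (~~ a), b, w; split=> //.
apply: projeq_trans (projeqM (projeq_refl T) Mw) _.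
case: a {Mw}; rewrite /= ?expr1 ?expr0 ?mulrA ?mulr1 ?heckeT_sq.
  by rewrite -!mulrA mulN1r mul1r; right.
by left.
Qed.

(** The rewriting rules are [U T = - V 1], [U (V j) = V (j + 1)] for [j < p - 1], and
    [U (V (p - 1)) = T], the last from [U ^+ p = -1]. *)
Lemma normal_form_U M : normal_form M -> normal_form (U * M).
Proof.
move=> [a [b [w [wp Mw]]]].
have UM := projeqM (projeq_refl U) Mw.
apply: normal_form_projeq UM _ => {Mw}.
have V1 : U * T = - V 1 by rewrite Vgen_heckeU // opprK expr1.
case: a => /=.
  exists false, b, (1%N :: w); split; first by apply/Vword_cons; split=> //; lia.
  by rewrite expr1 expr0 !mulrA V1 mul1r Vprod_cons !mulNr; right.
rewrite expr0 mul1r; case: w wp => [_|j w /Vword_cons[jp wp]].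
  (* For the empty word, [U = V 1 * T] toggles the trailing [T]. *)
  exists false, (~~ b), [:: 1%N]; split; first by apply/Vword_cons; split=> //; lia.
  rewrite expr0 mul1r Vprod_nil mul1r Vprod_cons Vprod_nil mulr1.
  have -> : V 1 = - (U * T) by rewrite V1 opprK.
  case: b => /=; rewrite expr1 expr0 mulr1; first by right; rewrite opprK.
  by left; rewrite mulNr -(mulrA U) heckeT_sq mulrN1 opprK.
have [jp1|jp1] := eqVneq j (p - 1)%N.
  exists true, b, w; split=> //.
  rewrite Vprod_cons Vgen_heckeU; last lia.
  rewrite !mulrA mulrN mulrA -exprS jp1.
  have -> : (p - 1).+1 = p by lia.
  by rewrite heckeU_p mulN1r opprK expr1; left.
exists false, b, (j.+1 :: w); split; first by apply/Vword_cons; split=> //; lia.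
rewrite expr0 mul1r !Vprod_cons !Vgen_heckeU //; try lia.
by rewrite !mulrA mulrN mulrA -exprS; left.
Qed.

Lemma normal_form_UX k M : normal_form M -> normal_form (U ^+ k * M).
Proof.
move=> M1; elim: k => [|k ih]; first by rewrite expr0 mul1r.
by rewrite exprS -mulrA; apply: normal_form_U.
Qed.

Lemma heckeT_inv : T^-1 = - T.
Proof.
by apply: (mulrI heckeT_unit); rewrite divrr ?heckeT_unit // mulrN heckeT_sq opprK.
Qed.

Lemma heckeU_inv : U^-1 = - U ^+ p.-1.
Proof.
apply: (mulrI heckeU_unit); rewrite divrr ?heckeU_unit // mulrN -exprS.
by rewrite prednK ?heckeU_p ?opprK //; lia.
Qed.

(** To pass through inverses, the induction shows that left multiplication by [M] and by [M^-1] both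
    preserve normal forms. Up to sign, [S] and its inverse are products of [T] and powers of [U]. *)
Lemma heckeG_normal_form M : heckeG p M -> normal_form M.
Proof.
move=> GM; suff H N : normal_form N -> normal_form (M * N) /\ normal_form (M^-1 * N).
  rewrite -[M]mulr1; apply: (H 1 _).1.
  by exists false, false, [::]; split=> //; rewrite Vprod_nil expr0 !mulr1; left.
elim: GM N => {M} [|||M M' GM ihM GM' ihM'|M GM ihM] N Nn.
- split.
    apply: (@normal_form_projeq _ (U * (T * N))).
      by rewrite heckeSE mulNr mulrA; right.
    exact/normal_form_U/normal_form_T.
  apply: (@normal_form_projeq _ (T * (U ^+ p.-1 * N))).
    rewrite heckeSE invrN invrM ?heckeU_unit ?heckeT_unit //.
    by rewrite heckeU_inv heckeT_inv !mulNr !mulrN opprK mulNr mulrA; right.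
  exact/normal_form_T/normal_form_UX.
- split; first exact: normal_form_T.
  rewrite heckeT_inv mulNr; apply: normal_form_projeq (projeqN _) _.
  exact: normal_form_T.
- by rewrite invr1 !mul1r.
- split; first by rewrite -mulrA; apply: (ihM _ _).1; apply: (ihM' _ _).1.
  rewrite invrM ?det1_unit ?(heckeG_det GM) ?(heckeG_det GM') // -mulrA.
  by apply: (ihM' _ _).2; apply: (ihM _ _).2.
- by split; rewrite ?invrK; [exact: (ihM _ _).2|exact: (ihM _ _).1].
Qed.

End Words.

(** * Transposition, discreteness and positive elements of the group *)

Section HeckeGroup.
Variables (R : realType) (p : nat).
Hypothesis p_ge3 : (3 <= p)%N.
Implicit Types (M N : 'M[R]_2) (u v w : seq nat).

Local Notation T := (heckeT R).
Local Notation Vprod := (Vprod R p).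

Lemma heckeGM M N : heckeG p M -> heckeG p N -> heckeG p (M * N).
Proof. exact: heckeG_M. Qed.

Lemma heckeGX M k : heckeG p M -> heckeG p (M ^+ k).
Proof.
move=> GM; elim: k => [|k ih]; first by rewrite expr0; exact: heckeG_1.
by rewrite exprS; exact: heckeGM.
Qed.

Lemma heckeGV M : heckeG p M -> heckeG p M^-1.
Proof. exact: heckeG_V. Qed.

Lemma heckeG_unit M : heckeG p M -> M \is a GRing.unit.
Proof. by move=> /heckeG_det/det1_unit. Qed.

(** In determinant 1, transposing amounts to inverting and conjugating by [T]; this is checked on
    the generators. *)
Lemma heckeG_trmx M : heckeG p M -> heckeG p M^T.
Proof.
have GTV : heckeG p T^-1 by apply: heckeGV; exact: heckeG_T.
elim=> {M} [|||M N _ GM _ GN|M _ GM].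
- suff -> : (heckeS R p)^T = T^-1 * (heckeS R p)^-1 * T.
    apply: heckeGM; last exact: heckeG_T.
    by apply: heckeGM => //; apply: heckeGV; exact: heckeG_S.
  rewrite heckeT_inv inv2E ?(heckeG_det (heckeG_S R p)) //.
  by apply: mx2_eq; rewrite trmx2E !mul2E !opp2E !mx2E; ring.
- suff -> : T^T = T^-1 by [].
  by rewrite heckeT_inv; apply: mx2_eq; rewrite trmx2E opp2E !mx2E; ring.
- by rewrite trmx1; exact: heckeG_1.
- by rewrite trmx_mul; exact: heckeGM.
- by rewrite trmx_inv; exact: heckeGV.
Qed.

Lemma heckeG_Vprod w : heckeG p (Vprod w).
Proof.
elim: w => [|j w ih]; first by rewrite Vprod_nil; exact: heckeG_1.
rewrite Vprod_cons; apply: heckeGM => //; apply: heckeGM; last exact: heckeG_S.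
by apply/heckeGX/heckeGM; [exact: heckeG_S|exact: heckeG_T].
Qed.

Lemma heckeG_cases M : heckeG p M -> exists2 w, Vword p w &
  [\/ projeq M (Vprod w), projeq M (T * Vprod w), projeq M (Vprod w * T)
   | projeq M (T * Vprod w * T)].
Proof.
move=> /(heckeG_normal_form p_ge3)[a [b [w [wp Mw]]]]; exists w => //.
by case: a b Mw => [] []; rewrite ?expr1 ?expr0 ?mul1r ?mulr1 => Mw;
  [apply: Or44|apply: Or42|apply: Or43|apply: Or41].
Qed.

Lemma heckeT_mulE N : ((T * N) 0 0 = - N 1 0) * ((T * N) 0 1 = - N 1 1) *
  ((T * N) 1 0 = N 0 0) * ((T * N) 1 1 = N 0 1).
Proof. by rewrite !mul2E !mx2E; do !split; ring. Qed.

Lemma mul_heckeTE N : ((N * T) 0 0 = N 0 1) * ((N * T) 0 1 = - N 0 0) *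
  ((N * T) 1 0 = N 1 1) * ((N * T) 1 1 = - N 1 0).
Proof. by rewrite !mul2E !mx2E; do !split; ring. Qed.

(** In [T w] and [w T] the diagonal of [w], at least 1, lands off the diagonal. The forms [w] and
    [T w T] keep the off-diagonal entries of [w] up to order and sign, and these sum to at least 1
    unless [w] is empty. The sign of [M 0 0] then leaves only 1. *)
Lemma heckeG_discrete M : heckeG p M -> 0 < M 0 0 ->
  `|M 0 1| + `|M 1 0| < 1 -> M = 1.
Proof.
move=> /heckeG_cases[w wp Mw] M0 Mlt1.
have /and4P[a b c d] := ge1mx_Vprod R p_ge3 wp.
have nilP : Vprod w 0 1 + Vprod w 1 0 < 1 -> w = [::].
  case: w {Mw a b c d} wp => // j w wp.
  by have /le_gtF -> := Vprod_cons_offdiag R p_ge3 wp.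
have absT : T * 1 * T = -1 by rewrite mulr1 heckeT_sq.
case: Mw => [] [] ME; move: M0 Mlt1;
  rewrite ME ?opp2E ?mul_heckeTE ?heckeT_mulE ?mul_heckeTE ?opprK ?normrN;
  move: a b c d nilP; set a := Vprod w 0 0; set b := Vprod w 0 1;
  set c := Vprod w 1 0; set d := Vprod w 1 1; move=> a1 b0 c0 d1 nilP M0 Mlt1;
  try (exfalso; have := ler_norm a; have := ler_norm d;
       have := normr_ge0 c; have := normr_ge0 b; have := normr_ge0 a;
       have := normr_ge0 d; clear -M0 Mlt1 a1 b0 c0 d1; lra);
  (have w0 : w = [::] by apply: nilP; have := ler_norm b; have := ler_norm c;
     clear -Mlt1; lra);
  by rewrite w0 Vprod_nil ?absT ?opprK.
Qed.

(** Each of the seven other signed normal forms has an entry that is at most 0. *)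
Lemma heckeG_pos_Vprod M : heckeG p M ->
  0 < M 0 0 -> 0 < M 0 1 -> 0 < M 1 0 -> 0 < M 1 1 ->
  exists2 w, Vword p w & M = Vprod w.
Proof.
move=> /heckeG_cases[w wp Mw] M00 M01 M10 M11; exists w => //.
have /and4P[a b c d] := ge1mx_Vprod R p_ge3 wp.
case: Mw => [] [] // ME; exfalso; move: M00 M01 M10 M11;
  rewrite ME ?opp2E ?mul_heckeTE ?heckeT_mulE ?mul_heckeTE {ME}; lra.
Qed.

End HeckeGroup.

(** * Commuting and conjugate words in a free monoid *)

Section WordCombinatorics.
Variable T : eqType.
Implicit Types u v w : seq T.

(** Euclid's algorithm on the lengths: the shorter word is a prefix of the longer one, and what
    remains still commutes with it. *)
Lemma cat_comm_power u v : u ++ v = v ++ u -> exists t i j,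
  u = flatten (nseq i t) /\ v = flatten (nseq j t).
Proof.
have [n] := ubnP (size u + size v); elim: n u v => // n ih u v uvn uv.
wlog suv : u v uvn uv / (size u <= size v)%N.
  move=> H; have [|/ltnW] := leqP (size u) (size v); first exact: H.
  by rewrite addnC in uvn => /(H _ _ uvn (esym uv))[t [i [j []]]]; exists t, j, i.
case: u uvn uv suv => [_ _ _|x u uvn uv suv].
  by exists v, 0%N, 1%N; rewrite /= cats0.
have vE : v = (x :: u) ++ drop (size (x :: u)) v.
  have /(congr1 (take (size (x :: u)))) := uv.
  by rewrite take_size_cat // takel_cat // => e; rewrite {1}e cat_take_drop.
move: uv; rewrite vE -catA => /eqP; rewrite eqseq_cat // eqxx => /eqP uv'.
have [|t [i [j [ui vj]]]] := ih _ _ _ uv'; last first.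
  by exists t, i, (i + j)%N; rewrite nseqD flatten_cat -ui -vj.
by move: uvn; rewrite {1}vE !size_cat /=; lia.
Qed.

(** The first letters of [u] and [w] agree; moving that letter to the end of [u] rotates [u] by one
    and shortens [w]. *)
Lemma cat_conj_rot u v w : u ++ w = w ++ v -> exists k, v = rot k u.
Proof.
elim: w u => [u|x w ih u]; first by rewrite cats0 /= => <-; exists 0%N; rewrite rot0.
case: u => [/= xw|y u [-> uw]].
  exists 0%N; apply/nilP; have /(congr1 size) := xw; rewrite /= size_cat /nilp.
  by rewrite /rot /=; lia.
have [|k ->] := ih (rcons u x); first by rewrite cat_rcons.
by rewrite -rot1_cons rot_rot_add; exists (rot_add (x :: u) 1 k).
Qed.

End WordCombinatorics.

(** * Fixed points, multipliers and the signs of matrix entries *)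

Section FixedPoints.
Variable R : realType.
Implicit Types (M N : 'M[R]_2) (x y : R).

(** The form Q_M at [(x, 1)]. Having no denominator, it passes easily to inverses and transposes. *)
Definition fixeq M x : Prop := M 1 0 * x ^+ 2 + (M 1 1 - M 0 0) * x - M 0 1 = 0.

(* The eigenvalue of [M] on [(x, 1)] when [x] is fixed; the derivative of the
   Moebius map at [x] is its inverse square. *)
Definition multiplier M x : R := M 1 0 * x + M 1 1.

(** The second factor is the trace minus the multiplier, hence the other eigenvalue. *)
Lemma multiplier_inv M x : \det M = 1 -> fixeq M x ->
  multiplier M x * (M 0 0 - x * M 1 0) = 1.
Proof.
rewrite det2E /fixeq /multiplier => M1 Mx.
by have := congr1 ( *%R (M 1 0)) Mx; rewrite mulr0; lra.
Qed.

Lemma multiplier_neq0 M x : \det M = 1 -> fixeq M x -> multiplier M x != 0.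
Proof.
move=> M1 Mx; apply/eqP => m0; have := multiplier_inv M1 Mx.
by rewrite m0 mul0r => /esym/eqP; rewrite oner_eq0.
Qed.

Lemma fixed_pointE M x : \det M = 1 -> fixed_point M x <-> fixeq M x.
Proof.
rewrite /fixed_point /mobius => M1; split=> [[m0]|Mx].
  by move=> /(canRL (divfK m0)); rewrite /fixeq; lra.
have m0 := multiplier_neq0 M1 Mx; split=> //.
apply: (canLR (mulfK m0)); move: Mx; rewrite /fixeq /multiplier; lra.
Qed.

Lemma derive1_mobius M x : \det M = 1 -> multiplier M x != 0 ->
  derive1 (mobius M) x = (multiplier M x ^+ 2)^-1.
Proof.
move=> M1 m0; rewrite derive1E.
have dnum (a b : R) : is_derive x 1 (fun z : R => a * z + b) a.
  have -> : (fun z : R => a * z + b) = (a *: (id : R -> R) + cst b).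
    by apply/funext => z; rewrite /= !fctE.
  have := is_deriveD (is_deriveZ a (is_derive_id x (1 : R)))
                     (is_derive_cst b x (1 : R)).
  by rewrite addr0 /GRing.scale /= mulr1.
have dden : is_derive x 1 (fun z : R => (M 1 0 * z + M 1 1)^-1)
   (- (M 1 0 * x + M 1 1) ^- 2 *: M 1 0).
  exact: is_deriveV.
have := is_deriveM (dnum (M 0 0) (M 0 1)) dden.
have -> : (fun z : R => M 0 0 * z + M 0 1) * (fun z : R => (M 1 0 * z + M 1 1)^-1)
   = mobius M by apply/funext.
move=> /@derive_val ->; rewrite /GRing.scale /=.
move: M1; rewrite det2E => M1; rewrite /multiplier in m0 *.
have -> : (M 0 0 * x + M 0 1) * (- (M 1 0 * x + M 1 1) ^- 2 * M 1 0) +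
   (M 1 0 * x + M 1 1)^-1 * M 0 0 = (M 0 0 * M 1 1 - M 0 1 * M 1 0) *
     (M 1 0 * x + M 1 1) ^- 2 by field.
by rewrite M1 mul1r.
Qed.

Lemma attractingE M x : \det M = 1 ->
  attracting M x <-> fixeq M x /\ 1 < multiplier M x ^+ 2.
Proof.
move=> M1; rewrite /attracting fixed_pointE //.
have aux : fixeq M x -> (`|derive1 (mobius M) x| < 1) = (1 < multiplier M x ^+ 2).
  move=> Mx; have m0 := multiplier_neq0 M1 Mx.
  have m2 : 0 < multiplier M x ^+ 2 by rewrite exprn_even_gt0.
  by rewrite derive1_mobius // gtr0_norm ?invr_gt0 // invf_lt1.
by split=> -[Mx m]; split=> //; [rewrite -(aux Mx)|rewrite (aux Mx)].
Qed.

(* Up to a scalar, the only matrix whose kernel and image are both the line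
   spanned by [(x, 1)]. *)
Definition nilmx x : 'M[R]_2 := mx2 x (- x ^+ 2) 1 (- x).

Lemma mul_nilmx M x : fixeq M x -> M * nilmx x = multiplier M x *: nilmx x.
Proof.
rewrite /fixeq /multiplier => Mx; have := congr1 ( *%R x) Mx; rewrite mulr0 => Mx2.
by apply: mx2_eq; rewrite mul2E !mxE /=; lra.
Qed.

(** [nilmx x] is the column [(x, 1)] times the row [(1, - x)], and this row is a left eigenvector
    for the other eigenvalue. *)
Lemma nilmx_mul M x : \det M = 1 -> fixeq M x ->
  nilmx x * M = (multiplier M x)^-1 *: nilmx x.
Proof.
move=> M1 Mx; have m0 := multiplier_neq0 M1 Mx.
have -> : (multiplier M x)^-1 = M 0 0 - x * M 1 0.
  by apply: (mulfI m0); rewrite divff // multiplier_inv.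
move: Mx; rewrite /fixeq => Mx; have := congr1 ( *%R x) Mx; rewrite mulr0 => Mx2.
by apply: mx2_eq; rewrite mul2E !mxE /=; lra.
Qed.

Lemma nilmx_annihilated M x : M * nilmx x = 0 -> nilmx x * M = 0 ->
  M = M 1 0 *: nilmx x.
Proof.
move=> /matrixP Mn /matrixP nM.
have := Mn 0 0; have := Mn 1 0; have := nM 1 0; have := nM 1 1.
rewrite !mul2E !mx2E !mxE => h1 h2 h3 h4.
have := congr1 ( *%R x) h2; rewrite mulr0 => h5.
by apply: mx2_eq; rewrite !mxE /=; lra.
Qed.

Lemma exp_unbounded (r B : R) : 1 < r -> exists k, B < r ^+ k.
Proof.
move=> r1; have bern k : 1 + k%:R * (r - 1) <= r ^+ k.
  elim: k => [|k ih]; first by rewrite mul0r expr0; lra.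
  rewrite exprS -natr1; have r0 : 0 <= r by lra.
  have := ler_wpM2l r0 ih; have := mulr_ge0 (ler0n R k) (sqr_ge0 (r - 1)); lra.
have [B0|B0] := ltP B 0; first by exists 0%N; rewrite expr0; lra.
have B1 : 0 <= B / (r - 1) by rewrite divr_ge0 //; lra.
have := archi_boundP B1; set k := Num.bound _ => Bk; exists k.
by apply: lt_le_trans (bern k); rewrite ltr_pdivrMr in Bk; lra.
Qed.

(** A multiplier [1] or [-1] would be a double eigenvalue, making the trace [2] or [-2]. *)
Lemma hyperbolic_multiplier M x : \det M = 1 -> hyperbolic M -> fixeq M x ->
  multiplier M x ^+ 2 != 1.
Proof.
move=> M1 hM Mx; apply/eqP => m2.
have mi := multiplier_inv M1 Mx.
have tE : \tr M = multiplier M x + (M 0 0 - x * M 1 0).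
  by rewrite tr2E /multiplier; lra.
have inv : M 0 0 - x * M 1 0 = multiplier M x.
  apply: (mulfI (multiplier_neq0 M1 Mx)); rewrite mi -expr2 m2 //.
move: hM; rewrite /hyperbolic tE inv.
have : `|multiplier M x| = 1.
  by apply/eqP; rewrite -sqrp_eq1 // real_normK ?num_real // m2.
by move=> n1; rewrite -mulr2n normrMn n1 ltxx.
Qed.

(** Once [c > 0] is known, Vieta gives [b = - c * (x * y) > 0]; then [a * d = 1 + b * c] and [a + d]
    are positive, so [a] and [d] are. *)
Lemma fixeq_pos M x y : \det M = 1 -> 0 < \tr M -> fixeq M x -> fixeq M y ->
  y < 0 < x -> 1 < multiplier M x ^+ 2 ->
  [/\ 0 < M 0 0, 0 < M 0 1, 0 < M 1 0 & 0 < M 1 1].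
Proof.
move=> M1 tM Mx My /andP[y0 x0] m2.
have mi := multiplier_inv M1 Mx.
move: tM Mx My m2 mi; move: M1; rewrite det2E tr2E /fixeq /multiplier.
set a := M 0 0; set b := M 0 1; set c := M 1 0; set d := M 1 1.
clearbody a b c d => {M} M1 tM Mx My m2 mi.
have xy0 : x - y != 0 by apply/eqP; lra.
have vieta1 : c * (x + y) + (d - a) = 0 by apply: (mulIf xy0); lra.
have vieta2 : b = - c * (x * y) by have := congr1 ( *%R x) vieta1; lra.
(* The multiplier at [y] is the other eigenvalue, so [c * (x - y)] is the difference of the two, and
   the larger one sits at [x]. *)
have muE : a - x * c = c * y + d by lra.
have sum : 0 < (c * x + d) + (c * y + d) by lra.
rewrite muE in mi; have c0 : 0 < c * (x - y).
  have -> : c * (x - y) = (c * x + d) - (c * y + d) by ring.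
  move: sum m2 mi; set m := c * x + d; set n := c * y + d => sum m2 mi.
  have m0 : 0 < m by nra.
  have m1 : 1 < m by rewrite expr_gt1 // ltW in m2.
  by nra.
have {}c0 : 0 < c by rewrite pmulr_lgt0 in c0 => //; lra.
have xy : x * y < 0 by rewrite pmulr_rlt0.
have b0 : 0 < b by rewrite vieta2 mulNr -mulrN mulr_gt0 // oppr_gt0.
have bc := mulr_gt0 b0 c0.
by split=> //; nra.
Qed.

(** The quadratic formula: [r] exceeds [a - d] and [d - a] because [b * c > 0], so the roots lie on
    either side of 0. *)
Lemma pos_fixeq M : \det M = 1 ->
  0 < M 0 0 -> 0 < M 0 1 -> 0 < M 1 0 -> 0 < M 1 1 ->
  exists x y, [/\ fixeq M x, fixeq M y, y < 0 < x & 1 < multiplier M x ^+ 2].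
Proof.
rewrite det2E /fixeq /multiplier.
set a := M 0 0; set b := M 0 1; set c := M 1 0; set d := M 1 1.
clearbody a b c d => {M} M1 a0 b0 c0 d0.
pose D := (d - a) ^+ 2 + 4 * b * c; pose r := Num.sqrt D.
have bc : 0 < b * c by rewrite mulr_gt0.
have D0 : 0 <= D by rewrite /D; have := sqr_ge0 (d - a); lra.
have r2 : r ^+ 2 = D by rewrite sqr_sqrtr.
have r0 : 0 <= r by rewrite sqrtr_ge0.
have cN : c != 0 by rewrite lt0r_neq0.
have lt_r e : e ^+ 2 = (d - a) ^+ 2 -> e < r.
  move=> e2; apply: le_lt_trans (ler_norm e) _.
  rewrite -(@ltr_pXn2r _ 2) ?nnegrE // real_normK ?num_real // e2 r2 /D; lra.
have r1 : a - d < r by apply: lt_r; ring.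
have r3 : d - a < r by exact: lt_r.
exists ((a - d + r) / (2 * c)), ((a - d - r) / (2 * c)).
have root (e : R) : e ^+ 2 = D ->
    c * ((a - d + e) / (2 * c)) ^+ 2 + (d - a) * ((a - d + e) / (2 * c)) - b = 0.
  move=> eD; have -> : c * ((a - d + e) / (2 * c)) ^+ 2 +
     (d - a) * ((a - d + e) / (2 * c)) - b =
     (e ^+ 2 - (d - a) ^+ 2 - 4 * b * c) / (4 * c) by field.
  by rewrite eD /D; ring.
split; [exact: root|by apply: root; rewrite sqrrN| |].
  by rewrite pmulr_llt0 ?invr_gt0 ?divr_gt0 //; try lra; nra.
have -> : c * ((a - d + r) / (2 * c)) + d = (a + d + r) / 2 by field.
(* The square of [a + d] is [(a - d) ^+ 2 + 4 * (1 + b * c)]. *)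
have ad : 2 < a + d.
  rewrite -(@ltr_pXn2r _ 2) ?nnegrE //; last lra.
  by have := sqr_ge0 (a - d); lra.
by rewrite expr_gt1 //; lra.
Qed.

End FixedPoints.

(** * Hyperbolic elements with a common fixed point *)

Section CommonFixedPoint.
Variables (R : realType) (p : nat).
Hypothesis p_ge3 : (3 <= p)%N.
Implicit Types (M N : 'M[R]_2) (x y : R).

Lemma fixeqV M x : \det M = 1 -> fixeq M x -> fixeq M^-1 x.
Proof. by move=> M1; rewrite /fixeq inv2E // !mx2E => Mx; lra. Qed.

Lemma multiplierV M x : \det M = 1 -> fixeq M x ->
  multiplier M^-1 x = (multiplier M x)^-1.
Proof.
move=> M1 Mx; apply: (mulfI (multiplier_neq0 M1 Mx)).
rewrite divff ?multiplier_neq0 // -(multiplier_inv M1 Mx).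
by rewrite /multiplier inv2E // !mx2E; ring.
Qed.

Lemma exp_mul_nilmx M x k : fixeq M x ->
  M ^+ k * nilmx x = multiplier M x ^+ k *: nilmx x.
Proof.
move=> Mx; elim: k => [|k ih]; first by rewrite !expr0 mul1r scale1r.
by rewrite exprSr -mulrA mul_nilmx // -scalerAr ih scalerA -exprS.
Qed.

Lemma nilmx_mul_exp M x k : \det M = 1 -> fixeq M x ->
  nilmx x * M ^+ k = (multiplier M x)^-1 ^+ k *: nilmx x.
Proof.
move=> M1 Mx; elim: k => [|k ih]; first by rewrite !expr0 mulr1 scale1r.
by rewrite exprS mulrA nilmx_mul // -scalerAl ih scalerA -exprS.
Qed.

(* The commutator of [M] and [N] is unipotent, and conjugating it by powers of
   [M] moves it arbitrarily close to the identity. *)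
Lemma heckeG_expanding_comm M N x : heckeG p M -> heckeG p N ->
  fixeq M x -> fixeq N x -> 1 < multiplier M x ^+ 2 -> M * N = N * M.
Proof.
move=> GM GN Mx Nx m2; have M1 := heckeG_det GM; have N1 := heckeG_det GN.
have Mu := heckeG_unit GM; have Nu := heckeG_unit GN.
have m0 := multiplier_neq0 M1 Mx; have n0 := multiplier_neq0 N1 Nx.
have MV1 : \det M^-1 = 1 by rewrite det_inv M1 invr1.
have NV1 : \det N^-1 = 1 by rewrite det_inv N1 invr1.
have MVx := fixeqV M1 Mx; have NVx := fixeqV N1 Nx.
set m := multiplier M x in m2 m0; set n := multiplier N x in n0.
pose D : 'M[R]_2 := M * N - N * M.
(* [M * N] and [N * M] multiply [nilmx x] by the same scalar on either side, so their difference
   annihilates it. *)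
have DE : D = D 1 0 *: nilmx x.
  apply: nilmx_annihilated; rewrite /D ?mulrBl ?mulrBr.
    rewrite -!mulrA !mul_nilmx // -!scalerAr !mul_nilmx // !scalerA.
    by rewrite mulrC subrr.
  rewrite !mulrA !nilmx_mul // -!scalerAl !nilmx_mul // !scalerA.
  by rewrite mulrC subrr.
pose P : 'M[R]_2 := M * N * (N * M)^-1.
have PE : P = 1 + (D 1 0 * (m * n)) *: nilmx x.
  have -> : P = 1 + D * (N * M)^-1.
    by rewrite /P /D mulrBl (divrr (heckeG_unit (heckeGM GN GM))) addrC subrK.
  rewrite invrM // [in LHS]DE -scalerAl (mulrA (nilmx x)) nilmx_mul // -scalerAl.
  by rewrite nilmx_mul // !multiplierV // !invrK !scalerA mulrA.
set t := D 1 0 * (m * n) in PE.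
(* Conjugation by [M ^+ k] scales the nilpotent part by [m ^- (2 k)]. The factor [1 + x ^+ 2 + |x|]
   bounds at once the off-diagonal entries and the change of the top left one, as [heckeG_discrete]
   demands. *)
have [k kP] := exp_unbounded (`|t| * (1 + x ^+ 2 + `|x|)) m2.
pose e := t * (m^-1 ^+ k * m^-1 ^+ k).
have GE : M^-1 ^+ k * P * M ^+ k = 1 + e *: nilmx x.
  rewrite PE mulrDr mulr1 mulrDl exprVn mulVr ?unitrX //.
  congr (_ + _); rewrite -exprVn -scalerAr -scalerAl exp_mul_nilmx //.
  by rewrite -scalerAl nilmx_mul_exp // multiplierV // !scalerA -mulrA.
have e_small : `|e| * (1 + x ^+ 2 + `|x|) < 1.
  have mk : 0 < (m ^+ 2) ^+ k by rewrite exprn_gt0 // exprn_even_gt0.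
  have -> : `|e| = `|t| / (m ^+ 2) ^+ k.
    rewrite /e normrM -exprMn -invfM -expr2 exprVn normfV.
    by rewrite (gtr0_norm mk).
  by rewrite mulrAC ltr_pdivrMr // mul1r.
have : 1 + e *: nilmx x = 1.
  apply: (@heckeG_discrete _ _ p_ge3).
  - rewrite -GE; do 2?[apply: heckeGM]; try exact: heckeGX.
      exact/heckeGX/heckeGV.
    by apply: heckeGM; [exact: heckeGM|exact/heckeGV/heckeGM].
  - rewrite !mxE /=; have := ler_norm (- (e * x)); rewrite normrN normrM.
    by have := mulr_ge0 (normr_ge0 e) (sqr_ge0 x); have := normr_ge0 e; lra.
  - rewrite !mxE /= !add0r mulr1 normrM normrN (ger0_norm (sqr_ge0 x)).
    by have := mulr_ge0 (normr_ge0 e) (normr_ge0 x); lra.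
move=> /matrixP/(_ 1 0); rewrite !mxE /= add0r mulr1 => /eqP.
rewrite /e /t !mulf_eq0 !expf_eq0 !invr_eq0 (negPf m0) (negPf n0) !andbF !orbF.
by move=> /eqP D0; apply/eqP; rewrite -subr_eq0 -/D DE D0 scale0r.
Qed.

(** Either [M] or its inverse has multiplier of square above 1 at [x], and commuting with one is
    commuting with the other. *)
Lemma heckeG_hyperbolic_comm M N x : heckeG p M -> heckeG p N ->
  hyperbolic M -> fixeq M x -> fixeq N x -> M * N = N * M.
Proof.
move=> GM GN hM Mx Nx; have M1 := heckeG_det GM.
have /(_ M1 hM Mx) := @hyperbolic_multiplier R M x.
rewrite neq_lt => /orP[m1|]; last exact: heckeG_expanding_comm.
have Mu := heckeG_unit GM.
have : M^-1 * N = N * M^-1.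
  apply: (@heckeG_expanding_comm _ _ x) => //; [exact: heckeGV|exact: fixeqV|].
  have m0 := multiplier_neq0 M1 Mx.
  by rewrite multiplierV // exprVn invf_gt1 // exprn_even_gt0.
by move=> /(congr1 (fun K => M * K * M)); rewrite mulVKr // !mulrA divrK.
Qed.

(** Commuting matrices have proportional forms [[c, d - a, - b]], so that of [M] vanishes wherever
    that of [N] does. *)
Lemma comm_fixeq M N x y : \det N = 1 -> hyperbolic N -> M * N = N * M ->
  x <> y -> fixeq N x -> fixeq N y -> fixeq M y.
Proof.
move=> N1 hN /matrixP MN xy Nx Ny.
(* Otherwise [N] is affine with two fixed points, so its diagonal entries agree and its trace has
   absolute value 2. *)
have N10 : N 1 0 != 0.
  apply/eqP => N10; move: Nx Ny; rewrite /fixeq N10 => Nx Ny.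
  have /eqP : (N 1 1 - N 0 0) * (x - y) = 0 by lra.
  rewrite mulf_eq0 !subr_eq0 => /orP[/eqP N11|/eqP //].
  move: hN N1; rewrite /hyperbolic tr2E det2E N10 N11 mulr0 subr0 => hN N1.
  have : `|N 0 0| = 1.
    by apply/eqP; rewrite -sqrp_eq1 // real_normK ?num_real // expr2 N1.
  by move=> n1; move: hN; rewrite -mulr2n normrMn n1 ltxx.
apply: (mulfI N10); rewrite mulr0.
have := MN 0 0; have := MN 1 0; rewrite !mul2E => h1 h2.
have := congr1 ( *%R (M 1 0)) Ny; have := congr1 ( *%R y) h1; rewrite mulr0.
by lra.
Qed.

(** The conjugate of [x] does not depend on the hyperbolic element that witnesses it. *)
Lemma hconj_fixeq M x y : heckeG p M -> hyperbolic M -> fixeq M x ->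
  hconj p x y -> fixeq M y /\ y <> x.
Proof.
move=> GM hM Mx [N [GN hN]]; have N1 := heckeG_det GN.
move=> /(fixed_pointE _ N1) Nx /(fixed_pointE _ N1) Ny yx; split=> //.
apply: (comm_fixeq N1 hN _ (nesym yx) Nx Ny).
exact: (heckeG_hyperbolic_comm GM GN hM Mx Nx).
Qed.

Lemma fixeq_hconj M x y : heckeG p M -> hyperbolic M -> fixeq M x ->
  fixeq M y -> y <> x -> hconj p x y.
Proof.
move=> GM hM Mx My yx; have M1 := heckeG_det GM.
by exists M; split=> //; exact/fixed_pointE.
Qed.

(** Simplicity of [x] makes both matrices positive, hence words. They commute, so they are powers of
    one word, and primitivity forces both exponents to be 1. *)
Lemma prim_hyp_attracting_uniq M N x : prim_hyp p M -> prim_hyp p N ->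
  attracting M x -> attracting N x -> simple p x -> M = N.
Proof.
move=> [GM tM hM pM] [GN tN hN pN].
have M1 := heckeG_det GM; have N1 := heckeG_det GN.
move=> /(attractingE _ M1)[Mx mM] /(attractingE _ N1)[Nx mN] [y xy yx].
have [My _] := hconj_fixeq GM hM Mx xy; have [Ny _] := hconj_fixeq GN hN Nx xy.
have [Ma Mb Mc Md] := fixeq_pos M1 tM Mx My yx mM.
have [Na Nb Nc Nd] := fixeq_pos N1 tN Nx Ny yx mN.
have [u up Mu] := heckeG_pos_Vprod p_ge3 GM Ma Mb Mc Md.
have [v vp Nv] := heckeG_pos_Vprod p_ge3 GN Na Nb Nc Nd.
have : u ++ v = v ++ u.
  apply: (@Vprod_inj R _ p_ge3); try exact/Vword_cat.
  rewrite !Vprod_cat -Mu -Nv; exact: (heckeG_hyperbolic_comm GM GN hM Mx Nx).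
move=> /cat_comm_power[t [i [j [ui vj]]]].
have powE k : Vprod R p (flatten (nseq k t)) = Vprod R p t ^+ k.
  elim: k => [|k ih]; first by rewrite Vprod_nil expr0.
  by rewrite /= Vprod_cat ih exprS.
(* Exponent 0 gives the identity, of trace 2; an exponent of at least 2 contradicts primitivity. *)
have exp1 K k : hyperbolic K -> primitive p K ->
    K = Vprod R p (flatten (nseq k t)) -> k = 1%N.
  case: k => [|[//|k]] hK pK KE.
    move: hK; rewrite KE Vprod_nil /hyperbolic mxtrace1 normr_nat.
    by rewrite ltxx.
  case: pK; exists (Vprod R p t), k.+2; split=> //; first exact: heckeG_Vprod.
  by rewrite KE powE; left.
rewrite {}ui in Mu; rewrite {}vj in Nv.
by rewrite Mu Nv (exp1 _ _ hM pM Mu) (exp1 _ _ hN pN Nv).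
Qed.

End CommonFixedPoint.

(** * Conjugate words are cyclic permutations of each other *)

Section ConjugateWords.
Variables (R : realType) (p : nat).
Hypothesis p_ge3 : (3 <= p)%N.
Implicit Types (M N g : 'M[R]_2) (u v w : seq nat).

Local Notation T := (heckeT R).
Local Notation Vprod := (Vprod R p).

(** [T] is the matrix of an alternating form, which determinant 1 preserves. *)
Lemma mul_heckeT_trmx M : \det M = 1 -> M * T * M^T = T.
Proof.
rewrite det2E => M1; apply: mx2_eq; rewrite !mul2E !trmx2E !mx2E; lra.
Qed.

Lemma trmx_mul_heckeT M : \det M = 1 -> M^T * T * M = T.
Proof.
rewrite det2E => M1; apply: mx2_eq; rewrite !mul2E !trmx2E !mx2E; lra.
Qed.

Lemma tr_word_rot k u : exists m, tr_word p (rot k u) = rot m (tr_word p u).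
Proof. by rewrite /tr_word rev_rot /rotr map_rot; eexists. Qed.

(* Writing [g] as [T^a w T^b], the relation [M^T T M = T] turns the equation
   into one between words; its length rules out [a <> b]. *)
Lemma Vprod_conj_rot u v g : Vword p u -> Vword p v -> u <> [::] ->
  heckeG p g -> Vprod u * g = g * Vprod v -> exists k, v = rot k u.
Proof.
move=> up vp u0 /(heckeG_cases p_ge3)[w wp gw] ugv.
have u1 := heckeG_det (heckeG_Vprod R p u); have v1 := heckeG_det (heckeG_Vprod R p v).
have Uu := heckeG_unit (heckeG_Vprod R p u).
have Vu := heckeG_unit (heckeG_Vprod R p v).
have Tu := heckeT_unit R.
have tup := Vword_tr_word p_ge3 up; have tvp := Vword_tr_word p_ge3 vp.
have sgn X : projeq g X -> Vprod u * X = X * Vprod v.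
  by case=> gX; move: ugv; rewrite gX // mulrN mulNr => /oppr_inj.
have size_neq (a b : seq nat) : size a = size u -> a ++ w ++ b <> w.
  by move=> au /(congr1 size); rewrite !size_cat au; case: (u) u0 => //= *; lia.
have TV : T * Vprod v \is a GRing.unit by rewrite unitrMl.
have UT : Vprod u * T \is a GRing.unit by rewrite unitrMl.
have sizet (a : seq nat) : size (tr_word p a) = size a by rewrite size_map size_rev.
case: gw => /sgn; rewrite ?mulrA => E.
- apply: (@cat_conj_rot _ u v w); apply: (@Vprod_inj R _ p_ge3); try exact/Vword_cat.
  by rewrite !Vprod_cat.
- exfalso; apply: (@size_neq (tr_word p u) v) => //.
  apply: (@Vprod_inj R _ p_ge3) => //; first by do 2![apply/Vword_cat; split=> //].
  rewrite !Vprod_cat -Vprod_trmx //; apply: (mulrI UT).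
  by rewrite !mulrA mul_heckeT_trmx // E.
- exfalso; apply: (@size_neq u (tr_word p v)) => //.
  apply: (@Vprod_inj R _ p_ge3) => //; first by do 2![apply/Vword_cat; split=> //].
  rewrite !Vprod_cat -Vprod_trmx //; apply: (mulIr TV).
  by rewrite -!mulrA (mulrA _ T) trmx_mul_heckeT // !mulrA E.
- have [k tvE] : exists k, tr_word p v = rot k (tr_word p u).
    apply: (@cat_conj_rot _ _ _ w); apply: (@Vprod_inj R _ p_ge3); try exact/Vword_cat.
    rewrite !Vprod_cat -!Vprod_trmx //; apply: (mulIr TV); apply: (mulrI UT).
    rewrite -!mulrA (mulrA (Vprod v)^T T) trmx_mul_heckeT // !mulrA.
    by rewrite mul_heckeT_trmx // E.
  have [m vE] := tr_word_rot k (tr_word p u).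
  by exists m; rewrite -(tr_wordK p_ge3 vp) tvE vE tr_wordK.
Qed.

End ConjugateWords.

(** * Quadratic forms: equivalence as conjugacy of matrices *)

Section Forms.
Variables (R : realType) (p : nat).
Implicit Types (M N g h : 'M[R]_2) (Q : bqf R) (A : set (bqf R)).

Lemma ZlambdaD (a b : R) : Zlambda p a -> Zlambda p b -> Zlambda p (a + b).
Proof.
by move=> [q ->] [r ->]; exists (q + r); rewrite rmorphD hornerD.
Qed.

Lemma ZlambdaM (a b : R) : Zlambda p a -> Zlambda p b -> Zlambda p (a * b).
Proof.
by move=> [q ->] [r ->]; exists (q * r); rewrite rmorphM hornerM.
Qed.

Lemma Zlambda_int (n : int) : Zlambda p (n%:~R : R).
Proof. by exists n%:P; rewrite map_polyC hornerC. Qed.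

Lemma ZlambdaN (a : R) : Zlambda p a -> Zlambda p (- a).
Proof. by move=> [q ->]; exists (- q); rewrite rmorphN hornerN. Qed.

Lemma Zlambda_lambda : Zlambda p (lambda R p).
Proof. by exists 'X; rewrite map_polyX hornerX. Qed.

(** Members of a [bqf_class] must have coefficients in Z[lambda], so the action has to stay inside
    that ring. *)
Lemma heckeG_Zlambda M : heckeG p M ->
  [/\ Zlambda p (M 0 0), Zlambda p (M 0 1), Zlambda p (M 1 0) & Zlambda p (M 1 1)].
Proof.
have Z0 := Zlambda_int 0; have Z1 := Zlambda_int 1; have ZN1 := Zlambda_int (-1).
elim=> {M} [|||M N _ [? ? ? ?] _ [? ? ? ?]|M GM [? ? ? ?]].
- by rewrite !mx2E; split=> //; exact: Zlambda_lambda.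
- by rewrite !mx2E; split.
- by rewrite !one2E; split.
- by rewrite !mul2E; split; apply: ZlambdaD; apply: ZlambdaM.
- rewrite (_ : invmx M = M^-1) // inv2E ?(heckeG_det GM) // !mx2E.
  by split=> //; exact: ZlambdaN.
Qed.

Lemma lambda_bqf_act Q g : lambda_bqf p Q -> heckeG p g ->
  lambda_bqf p (bqf_act Q g).
Proof.
case: Q => a b c [/= ? ? ?] /heckeG_Zlambda[? ? ? ?].
have Z2 : Zlambda p (2 : R) := Zlambda_int 2.
by split; rewrite /= ?expr2; do !(assumption || apply: ZlambdaD || apply: ZlambdaM).
Qed.

Lemma bqf_actM Q g h : bqf_act (bqf_act Q g) h = bqf_act Q (g * h).
Proof.
by case: Q => a b c; rewrite /bqf_act !mul2E; congr BQF; ring.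
Qed.

Lemma bqf_act_of_mx M g : \det g = 1 ->
  bqf_act (bqf_of_mx M) g = bqf_of_mx (g^-1 * M * g).
Proof.
by move=> g1; rewrite /bqf_of_mx !mul2E inv2E // !mx2E; congr BQF; ring.
Qed.

(** The form gives [b], [c] and [d - a]; the determinant then gives the square of the trace, and
    positivity its sign. *)
Lemma bqf_of_mx_inj M N : \det M = 1 -> \det N = 1 -> 0 < \tr M -> 0 < \tr N ->
  bqf_of_mx M = bqf_of_mx N -> M = N.
Proof.
rewrite !det2E !tr2E => M1 N1 tM tN [h10 hd h01].
have tE : M 0 0 + M 1 1 = N 0 0 + N 1 1.
  apply/eqP; rewrite -(@eqrXn2 _ 2) // ?ltW //; apply/eqP.
  rewrite h10 (oppr_inj h01) in M1.
  by have := congr1 (fun z => z ^+ 2) hd; lra.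
by apply: mx2_eq; move: h01; lra.
Qed.

Lemma mxtrace_conj M g : heckeG p g ->
  \tr (g^-1 * M * g) = \tr M.
Proof.
by move=> Gg; rewrite mxtrace_mulC mulmxE (mulVKr (heckeG_unit Gg)).
Qed.

Lemma prim_hyp_trmx M : prim_hyp p M -> prim_hyp p M^T.
Proof.
move=> [GM tM hM pM]; split; rewrite /hyperbolic ?mxtrace_tr //.
  exact: heckeG_trmx.
move=> [N [k [GN k2 MN]]]; apply: pM; exists N^T, k; split=> //.
  exact: heckeG_trmx.
by have := projeq_trmx MN; rewrite trmxK trmxXr.
Qed.

(** Forms transform by [bqf_act_of_mx], and positive traces let a form determine its matrix, so
    conjugacy holds here without a sign. *)
Lemma bqf_class_conj A M N : bqf_class p A -> prim_hyp p M -> A (bqf_of_mx M) ->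
  prim_hyp p N ->
  A (bqf_of_mx N) <-> exists2 g, heckeG p g & N = g^-1 * M * g.
Proof.
move=> [Q0 _ ->] [GM tM hM pM] /= [lM [g Gg MQ]] [GN tN hN pN].
have g1 := heckeG_det Gg.
split=> [[lN [h Gh NQ]]|[k Gk NE]].
  have Gk : heckeG p (g^-1 * h) by apply: heckeGM => //; exact: heckeGV.
  exists (g^-1 * h) => //; apply: bqf_of_mx_inj; rewrite ?mxtrace_conj //.
  - exact: heckeG_det GN.
  - apply: (@heckeG_det _ p); apply: heckeGM => //; apply: heckeGM => //.
    exact: heckeGV.
  rewrite -bqf_act_of_mx ?(heckeG_det Gk) // MQ bqf_actM mulrA divrr ?mul1r //.
  exact: heckeG_unit Gg.
rewrite NE -bqf_act_of_mx ?(heckeG_det Gk) //; split; first exact: lambda_bqf_act.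
by exists (g * k); [exact: heckeGM|rewrite MQ bqf_actM].
Qed.

End Forms.

(** * Positive matrices of a class, its poles and transposition *)

Section PositiveMatrices.
Variables (R : realType) (p : nat).
Hypothesis p_ge3 : (3 <= p)%N.
Implicit Types (M N g h : 'M[R]_2) (x y : R) (A : set (bqf R)).

Definition posmx M : Prop := [/\ 0 < M 0 0, 0 < M 0 1, 0 < M 1 0 & 0 < M 1 1].

Lemma posmx_trmx M : posmx M -> posmx M^T.
Proof. by move=> [? ? ? ?]; split; rewrite trmx2E. Qed.

(** Distinct roots would have product [- b / c], which is negative. *)
Lemma posmx_root_uniq M x y : posmx M -> fixeq M x -> fixeq M y -> 0 < x * y -> x = y.
Proof.
move=> [_ b0 c0 _]; rewrite /fixeq => Mx My xy0.
apply/eqP; rewrite -subr_eq0; apply/eqP; apply/eqP; apply: contraT => xy.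
have vieta1 : M 1 0 * (x + y) + (M 1 1 - M 0 0) = 0 by apply: (mulIf xy); lra.
have vieta2 : M 0 1 = - (M 1 0 * (x * y)) by have := congr1 ( *%R x) vieta1; lra.
by have := mulr_gt0 c0 xy0; lra.
Qed.

(** The multiplier exceeds [d], and also [a] since its product with [x] is [a * x + b]; its square
    therefore exceeds [a * d = 1 + b * c]. *)
Lemma posmx_multiplier M x : \det M = 1 -> posmx M -> fixeq M x -> 0 < x ->
  1 < multiplier M x ^+ 2.
Proof.
move=> M1 [a0 b0 c0 d0] Mx x0; have cx := mulr_gt0 c0 x0.
have md : M 1 1 < multiplier M x by rewrite /multiplier; lra.
have ma : M 0 0 < multiplier M x.
  rewrite -(ltr_pM2r x0) /multiplier; move: Mx; rewrite /fixeq; lra.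
have := ltr_pM (ltW a0) (ltW d0) ma md; rewrite -expr2.
move: M1; rewrite det2E; have := mulr_gt0 b0 c0; lra.
Qed.

(** In determinant 1, [M^T] is conjugate by [T] to [M^-1], which has the fixed points of [M]; hence
    the image of [x] under [T]. *)
Lemma fixeq_trmx M x : x != 0 -> fixeq M x -> fixeq M^T (- x^-1).
Proof.
rewrite /fixeq !trmx2E => x0 Mx; apply: (mulIf (expf_neq0 2 x0)); rewrite mul0r.
have -> : (M 0 1 * (- x^-1) ^+ 2 + (M 1 1 - M 0 0) * - x^-1 - M 1 0) * x ^+ 2 =
  M 0 1 - (M 1 1 - M 0 0) * x - M 1 0 * x ^+ 2 by field.
by lra.
Qed.

Lemma mobius_heckeT x : mobius (heckeT R) x = - x^-1.
Proof. by rewrite /mobius !mx2E mul0r add0r mul1r addr0 mulN1r. Qed.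

(** [Zset], [Mset] and [ISP] are all described through these matrices, which makes the conditions of
    the theorem comparable. *)
Definition reduced A M : Prop := [/\ prim_hyp p M, A (bqf_of_mx M) & posmx M].

Lemma reduced_det A M : reduced A M -> \det M = 1.
Proof. by case=> -[/heckeG_det]. Qed.

Lemma reduced_roots A M : reduced A M ->
  exists x y, [/\ fixeq M x, fixeq M y, 0 < x & y < 0].
Proof.
move=> rM; have M1 := reduced_det rM; case: rM => _ _ [a b c d].
by have [x [y [Mx My /andP[y0 x0] _]]] := pos_fixeq M1 a b c d; exists x, y.
Qed.

Lemma prim_hyp_simple M x : prim_hyp p M -> posmx M -> fixeq M x -> 0 < x ->
  attracting M x /\ simple p x.
Proof.
move=> [GM tM hM pM] pos Mx x0; have M1 := heckeG_det GM.
split; first by apply/attractingE => //; split=> //; exact: posmx_multiplier.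
have [a b c d] := pos; have [_ [y [_ My /andP[y0 _] _]]] := pos_fixeq M1 a b c d.
exists y; last by rewrite y0.
by apply: (fixeq_hconj GM hM Mx My) => yx; move: x0; rewrite -yx ltNge ltW.
Qed.

Lemma ZsetP A x : Zset p A x <-> exists M, [/\ reduced A M, fixeq M x & 0 < x].
Proof.
split=> [[[y xy yx] [Q [M [pM aM] ->] AQ]]|[M [[pM AM pos] Mx x0]]].
  have [GM tM hM _] := pM; have M1 := heckeG_det GM.
  have [Mx mM] := (attractingE x M1).1 aM.
  have [My _] := hconj_fixeq p_ge3 GM hM Mx xy.
  have /andP[_ x0] := yx.
  by exists M; split=> //; split=> //; exact: (fixeq_pos M1 tM Mx My yx mM).
have [aM sx] := prim_hyp_simple pM pos Mx x0.
by split=> //; exists (bqf_of_mx M) => //; exists M.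
Qed.

(** Uniqueness of the primitive element attracting to [x] identifies [M] with the positive matrix
    supplied by [ZsetP]. *)
Lemma MsetP A M : Mset p A M <-> reduced A M.
Proof.
split=> [[x Zx [pM aM]]|rM].
  have /ZsetP[N [rN Nx x0]] := Zx; have [pN _ pos] := rN.
  have [aN sx] := prim_hyp_simple pN pos Nx x0.
  by rewrite (prim_hyp_attracting_uniq p_ge3 pM pN aM aN sx).
have [x [_ [Mx _ x0 _]]] := reduced_roots rM; have [pM _ pos] := rM.
exists x; first by apply/ZsetP; exists M.
by split=> //; exact: (prim_hyp_simple pM pos Mx x0).1.
Qed.

Lemma ISPP A z : ISP p A z <->
  exists M x, [/\ reduced A M, fixeq M x, 0 < x & z = x \/ z = - x^-1].
Proof.
split=> [[/ZsetP[M [rM Mx x0]]|[x /ZsetP[M [rM Mx x0]] <-]]|].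
- by exists M, z; split=> //; left.
- by exists M, x; split=> //; right; rewrite mobius_heckeT.
move=> [M [x [rM Mx x0 zx]]]; have Zx : Zset p A x by apply/ZsetP; exists M.
by case: zx => ->; [left|right; exists x; rewrite // mobius_heckeT].
Qed.

Lemma hconj_ISPP A z : hconj_set p (ISP p A) z <->
  exists M y, [/\ reduced A M, fixeq M y, y < 0 & z = y \/ z = - y^-1].
Proof.
split=> [[t /ISPP[M [x [rM Mx x0 tx]]] tz]|[M [y [rM My y0 zy]]]].
  have [pM _ pos] := rM; have [GM tM hM _] := pM.
  have [GT _ hT _] := prim_hyp_trmx pM.
  case: tx => tE; rewrite {}tE in tz.
    have [Mz zx] := hconj_fixeq p_ge3 GM hM Mx tz.
    exists M, z; split=> //; last by left.
    (* The constant coefficient is nonzero, so [z] is not 0; a positive [z] would coincide with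
       [x]. *)
    rewrite ltNge; apply/negP; rewrite le_eqVlt => /predU1P[z0|z0].
      by case: pos => _ + _ _; move: Mz; rewrite /fixeq -z0; lra.
    by apply: zx; apply: (posmx_root_uniq pos Mz Mx); rewrite mulr_gt0.
  (* The pole [- x^-1] is a negative root of [M^T], so its conjugate is the positive root of
     [M^T]. *)
  have Tx := fixeq_trmx (lt0r_neq0 x0) Mx.
  have [Tz zx] := hconj_fixeq p_ge3 GT hT Tx tz.
  have z0 : 0 < z.
    rewrite ltNge; apply/negP; rewrite le_eqVlt => /predU1P[z0|z0].
      by case: (posmx_trmx pos) => _ + _ _; move: Tz; rewrite /fixeq z0; lra.
    apply: zx; apply: (posmx_root_uniq (posmx_trmx pos) Tz Tx).
    by rewrite nmulr_lgt0 // oppr_lt0 invr_gt0.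
  exists M, (- z^-1); split=> //; last by right; rewrite invrN opprK invrK.
    by have := fixeq_trmx (lt0r_neq0 z0) Tz; rewrite trmxK.
  by rewrite oppr_lt0 invr_gt0.
have [x [_ [Mx _ x0 _]]] := reduced_roots rM.
have [pM _ pos] := rM; have [GM tM hM _] := pM.
have yx : y <> x by move=> yx; move: x0; rewrite -yx ltNge ltW.
case: zy => ->.
  exists x; first by apply/ISPP; exists M, x; split=> //; left.
  exact: (fixeq_hconj GM hM Mx My).
exists (- x^-1); first by apply/ISPP; exists M, x; split=> //; right.
have [GT _ hT _] := prim_hyp_trmx pM.
apply: (fixeq_hconj GT hT).
- by apply: fixeq_trmx Mx; rewrite lt0r_neq0.
- by apply: fixeq_trmx My; rewrite ltr0_neq0.
- by move=> /oppr_inj/invr_inj.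
Qed.

(** Transposition preserves primitivity and positivity, so only membership in [A] is at stake. *)
Lemma reduced_trmxP A : (forall M, reduced A M -> A (bqf_of_mx M^T)) <->
  trmx @` Mset p A = Mset p A.
Proof.
split=> [H|H M rM].
  have HT M : reduced A M -> reduced A M^T.
    move=> rM; have [pM AM pos] := rM.
    by split; [exact: prim_hyp_trmx|exact: H|exact: posmx_trmx].
  apply/seteqP; split=> M /=.
    by move=> [N /MsetP rN <-]; apply/MsetP; exact: HT.
  by move=> /MsetP rM; exists M^T; rewrite ?trmxK //; apply/MsetP; exact: HT.
suff /MsetP[] : Mset p A M^T by [].
by rewrite -H; exists M => //; exact/MsetP.
Qed.

(** Transposition turns the negative root [y] of [M] into the positive root [- y^-1] of [M^T], which
    gives one direction. Conversely this root is a positive pole, hence attracting for some reduced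
    [N], and uniqueness gives [M^T = N]. *)
Lemma reduced_trmx_ISP A : (forall M, reduced A M -> A (bqf_of_mx M^T)) <->
  hconj_set p (ISP p A) = ISP p A.
Proof.
split=> [H|H M rM]; last first.
  have [_ [y [_ My _ y0]]] := reduced_roots rM; have [pM _ pos] := rM.
  have yT0 : 0 < - y^-1 by rewrite oppr_gt0 invr_lt0.
  have : ISP p A (- y^-1).
    by rewrite -H; apply/hconj_ISPP; exists M, y; split=> //; right.
  move=> /ISPP[N [x [rN Nx x0 [yx|/oppr_inj/invr_inj yx]]]]; last first.
    by move: x0; rewrite -yx ltNge ltW.
  have Tx := fixeq_trmx (ltr0_neq0 y0) My; rewrite yx in Tx.
  have [pN AN posN] := rN.
  have [aN sx] := prim_hyp_simple pN posN Nx x0.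
  have pT := prim_hyp_trmx pM.
  have [aT _] := prim_hyp_simple pT (posmx_trmx pos) Tx x0.
  by rewrite (prim_hyp_attracting_uniq p_ge3 pT pN aT aN sx).
have HT M : reduced A M -> reduced A M^T.
  move=> rM; have [pM AM pos] := rM.
  by split; [exact: prim_hyp_trmx|exact: H|exact: posmx_trmx].
apply/seteqP; split=> z.
  move=> /hconj_ISPP[M [y [/HT rM My y0 zy]]]; apply/ISPP.
  exists M^T, (- y^-1); rewrite invrN opprK invrK oppr_gt0 invr_lt0.
  split=> //; first by apply: fixeq_trmx My; rewrite ltr0_neq0.
  by case: zy => ->; [right|left].
move=> /ISPP[M [x [/HT rM Mx x0 zx]]]; apply/hconj_ISPP.
exists M^T, (- x^-1); rewrite invrN opprK invrK oppr_lt0 invr_gt0.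
split=> //; first by apply: fixeq_trmx Mx; rewrite lt0r_neq0.
by case: zx => ->; [right|left].
Qed.

Lemma Vprod_reduced A js : Vword p js -> conj_class_of p A (Vprod R p js) ->
  reduced A (Vprod R p js).
Proof.
move=> jsp [M [WM pM AM]].
have /and4P[a b c d] := ge1mx_Vprod R p_ge3 jsp.
have [GM tM hM _] := pM.
have tW : 0 < \tr (Vprod R p js) by rewrite tr2E; lra.
have E := projeq_tr_eq tW tM WM; rewrite -{}E in pM AM GM tM hM {WM}.
split=> //; have := heckeG_det GM; move: hM; rewrite /hyperbolic gtr0_norm //.
rewrite det2E tr2E => hW W1.
(* Both diagonal entries are at least 1 and their sum exceeds 2, so their product exceeds 1. *)
have bc : 0 < Vprod R p js 0 1 * Vprod R p js 1 0 by nra.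
split; try lra.
- by rewrite lt0r b andbT; apply/eqP => b0; move: bc; rewrite b0 mul0r ltxx.
- by rewrite lt0r c andbT; apply/eqP => c0; move: bc; rewrite c0 mulr0 ltxx.
Qed.

End PositiveMatrices.

Theorem theorem4p8 (R : realType) (p : nat) (p_ge3 : (3 <= p)%N)
    (A : set (bqf R)) (A_hyp : hyperbolic_class p A)
    (js : seq nat) (js_word : Vword p js)
    (W_class : conj_class_of p A (Vprod R p js)) :
  projeq (Vprod R p js)^T (Vprod R p (tr_word p js)) /\
  [<-> hconj_set p (ISP p A) = ISP p A;
       trmx @` Mset p A = Mset p A;
       hecke_conjugate p (Vprod R p js)^T (Vprod R p js);
       cyclic_perm (tr_word p js) js].
Proof.
have WT := Vprod_trmx R p_ge3 js_word.
split; first by rewrite WT; left.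
have Acl := A_hyp.1.
have rW := Vprod_reduced p_ge3 js_word W_class; have [pW AW _] := rW.
have pT := prim_hyp_trmx pW; have [_ tW hW _] := pW.
set W := Vprod R p js in WT rW pW AW pT tW hW *.
have cd : hecke_conjugate p W^T W -> cyclic_perm (tr_word p js) js.
  move=> [g Gg]; have gu := heckeG_unit Gg => WE.
  (* Both sides have positive trace, which removes the sign. *)
  have {}WE : W = g^-1 * W^T * g.
    by apply: projeq_tr_eq => //; rewrite (mxtrace_conj _ Gg) mxtrace_tr.
  have js0 : js <> [::].
    move=> js0; move: hW; rewrite /W js0 Vprod_nil /hyperbolic mxtrace1.
    by rewrite normr_nat ltxx.
  apply: (@Vprod_conj_rot R _ p_ge3 _ _ g^-1) => //.
  - exact: Vword_tr_word.
  - exact: heckeGV.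
  by rewrite -WT -/W [in LHS]WE mulrK.
have dc : cyclic_perm (tr_word p js) js -> hecke_conjugate p W^T W.
  (* [W^T] is [drop k js] followed by [take k js]; conjugating by the first factor swaps the two. *)
  move=> [k kE]; exists (Vprod R p (drop k js)); first exact: heckeG_Vprod.
  left; rewrite WT kE /rot Vprod_cat !mulmxE /W -{1}(cat_take_drop k js) Vprod_cat.
  by rewrite mulKr // (heckeG_unit (heckeG_Vprod R p _)).
have cb : hecke_conjugate p W^T W -> forall M, reduced p A M -> A (bqf_of_mx M^T).
  move=> [g Gg WE] M [pM AM _]; have gu := heckeG_unit Gg.
  have {}WE : W = g^-1 * W^T * g.
    by apply: projeq_tr_eq => //; rewrite (mxtrace_conj _ Gg) mxtrace_tr.
  have [k Gk ME] := (bqf_class_conj Acl pW AW pM).1 AM; have ku := heckeG_unit Gk.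
  have ktu := heckeG_unit (heckeG_trmx Gk).
  apply/(bqf_class_conj Acl pW AW (prim_hyp_trmx pM)).
  (* From [M = k^-1 * W * k] and [W^T = g * W * g^-1] one gets
     [M^T = (k^T * g) * W * (k^T * g)^-1]. *)
  exists (g^-1 * (k^T)^-1).
    by apply: heckeGM; apply: heckeGV => //; exact: heckeG_trmx.
  rewrite invrM ?unitrV // !invrK ME !trmxMr trmxVr {2}WE.
  by rewrite !mulrA !mulrK // (mulrK gu).
have bc : (forall M, reduced p A M -> A (bqf_of_mx M^T)) -> hecke_conjugate p W^T W.
  move=> /(_ _ rW) AT.
  by have [g Gg WE] := (bqf_class_conj Acl pT AT pW).1 AW; exists g => //; left.
(* The cycle passes through the stability of reduced matrices under transposition, which is
   equivalent to each of the first two conditions. *)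
tfae.
- by move=> /(reduced_trmx_ISP p_ge3)/(reduced_trmxP p_ge3).
- by move=> /(reduced_trmxP p_ge3).
- exact: cd.
- by move=> /dc/cb/(reduced_trmx_ISP p_ge3).
Qed.
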